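(* Let $(M,F)$ be a Finsler structure. If there is a Riemannian metric $h$ on $M$, with Levi-Civita connection $\nabla^h$, that leaves the indicatrix of $F$ invariant under the parallel transport of $\pi^*\nabla^h$ (i.e. for every path $\gamma$ in $M$ from $x$ to $z$, $\nabla^h$-parallel transport along $\gamma$ maps $I_x$ onto $I_z$), then $(M,F)$ is a Berwald structure.
   Context: Finsler structure: $M$ is a smooth $n$-manifold, $N=TM\setminus\{0\}$, $\pi:N\to M$; $F:TM\to[0,\infty)$ is smooth on $N$, satisfies $F(x,\lambda y)=\lambda F(x,y)$ for $\lambda>0$, and $g_{ij}(x,y)=\frac12\frac{\partial^2F^2}{\partial y^i\partial y^j}$ is positive definite on $N$. The indicatrix at $x$ is $I_x=\{y\in T_xM:F(x,y)=1\}$. Put $A_{ijk}=\frac F2\frac{\partial g_{ij}}{\partial y^k}$, $\gamma^i_{jk}=\frac12 g^{is}(\partial_{x^k}g_{sj}-\partial_{x^s}g_{jk}+\partial_{x^j}g_{sk})$, $N^i_j=\gamma^i_{jk}y^k-\frac1F A^i_{jk}\gamma^k_{rs}y^ry^s$ (indices are raised with $g^{ij}$), $\frac{\delta}{\delta x^j}=\frac{\partial}{\partial x^j}-N^i_j\frac{\partial}{\partial y^i}$ (horizontal vectors), $\delta y^i=dy^i+N^i_jdx^j$. Chern connection: $\pi^*TM\to N$ is the pull-back bundle, with fibre $T_{\pi(u)}M$ over $u$. The Chern connection is the unique linear connection on $\pi^*TM$ with connection forms $\omega^i_j=\Gamma^i_{jk}(x,y)dx^k$, $\Gamma^i_{jk}=\Gamma^i_{kj}$,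 and $dg_{ij}-g_{kj}\omega^k_i-g_{ik}\omega^k_j=2A_{ijk}\frac{\delta y^k}{F}$. $(M,F)$ is Berwald if the $\Gamma^i_{jk}$ in natural coordinates do not depend on $y$. The pull-back connection $\pi^*\nabla^h$ on $\pi^*TM\to N$ is defined by $(\pi^*\nabla^h)_{\iota(X)}\pi^*S=\pi^*(\nabla^h_XS)$ for vector fields $X,S$ on $M$, where $\iota(X)=X^i\frac{\delta}{\delta x^i}$, with zero vertical covariant derivative of sections $\pi^*S$; its parallel transport along horizontal lifts of a path in $M$ is, under the identification of fibres with tangent spaces of $M$, $\nabla^h$-parallel transport along the path. *)

(* Defs.v *)
From HB Require Import structures.
From mathcomp Require Import all_boot all_order all_algebra.
From mathcomp Require Import all_classical all_reals all_analysis.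
Import Order.TTheory GRing.Theory Num.Theory.
Import numFieldNormedType.Exports.

Set Implicit Arguments.
Unset Strict Implicit.
Unset Printing Implicit Defensive.

Local Open Scope classical_set_scope.
Local Open Scope ring_scope.

Section Smooth.
Context {R : realType}.

Definition iter_derive (V W : normedModType R) (vs : seq V) (f : V -> W) :
  V -> W := foldr (fun v g x => 'D_v g x) f vs.

(* C^oo on an open set U of a finite-dimensional space; values of f outside U
   are irrelevant. *)
Definition smooth_on (V W : normedModType R) (U : set V) (f : V -> W) : Prop :=
  forall (vs : seq V) (x : V), U x -> differentiable (iter_derive vs f) x.

Definition basis_vec n (j : 'I_n) : 'cV[R]_n := delta_mx j 0.

(* entry (i, j) is d f^i / d x^j *)
Definition jac n (f : 'cV[R]_n -> 'cV[R]_n) (x : 'cV[R]_n) : 'M[R]_n :=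
  \matrix_(i, j) ('D_(basis_vec j) f x) i 0.

Lemma jacE n (f : 'cV[R]_n -> 'cV[R]_n) x v :
  differentiable f x -> jac f x *m v = 'd f x v.
Proof.
move=> df; have dv : v = \sum_j v j 0 *: basis_vec j.
  apply/matrixP => i k; rewrite (ord1 k) summxE (bigD1 i) //= big1 => [|j ji].
    by rewrite !mxE !eqxx mulr1 addr0.
  by rewrite !mxE eq_sym (negbTE ji) mulr0.
rewrite [in RHS]dv linear_sum; apply/matrixP => i k; rewrite (ord1 k).
rewrite mxE summxE; apply: eq_bigr => j _.
by rewrite linearZ !mxE deriveE // mulrC.
Qed.

Lemma near_jac n (f g : 'cV[R]_n -> 'cV[R]_n) x :
  (\forall z \near x, f z = g z) -> jac f x = jac g x.
Proof.
move=> fg; apply/matrixP => i j; rewrite !mxE.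
by congr ((_ : 'cV_n) _ _); exact: near_eq_derive.
Qed.

End Smooth.

(* A chart is a homeomorphism from the open set chart_dom onto the open set
   chart_cod; chart_map and chart_inv are total, with irrelevant values
   elsewhere. *)
Record chart (R : realType) (n : nat) (M : topologicalType) := Chart {
  chart_dom : set M;
  chart_map :> M -> 'cV[R]_n;
  chart_inv : 'cV[R]_n -> M;
  chart_dom_open : open chart_dom;
  chart_cod_open : open (chart_map @` chart_dom);
  chart_continuous : {within chart_dom, continuous chart_map};
  chart_inv_continuous :
    {within chart_map @` chart_dom, continuous chart_inv};
  chart_mapK : forall p, chart_dom p -> chart_inv (chart_map p) = p }.

Section ChartTheory.
Context {R : realType} {n : nat} {M : topologicalType}.
Implicit Types c d : chart R n M.

Definition chart_cod c : set 'cV[R]_n := c @` chart_dom c.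

Definition transition c d : 'cV[R]_n -> 'cV[R]_n := d \o chart_inv c.

Definition overlap c d : set 'cV[R]_n :=
  c @` (chart_dom c `&` chart_dom d).

Definition chart_compatible c d : Prop :=
  smooth_on (overlap c d) (transition c d) /\
  smooth_on (overlap d c) (transition d c).

End ChartTheory.

Record manifold (R : realType) (n : nat) := Manifold {
  mcarrier :> topologicalType;
  atlas : set (chart R n mcarrier);
  manifold_hausdorff : hausdorff_space mcarrier;
  manifold_second_countable : @second_countable mcarrier;
  atlas_cover : forall p, exists2 c, atlas c & chart_dom c p;
  atlas_compatible :
    forall c d, atlas c -> atlas d -> chart_compatible c d;
  atlas_maximal :
    forall c, (forall d, atlas d -> chart_compatible c d) -> atlas c }.

Section Tangent.
Context {R : realType} {n : nat} {M : manifold R n}.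
Implicit Types (p : M) (c d e : chart R n M).

Definition chart_at p c : Prop := atlas c /\ chart_dom c p.

(* A tangent vector at p assigns to each chart of the atlas around p a column of
   components, transforming by the Jacobians of the transition maps; the
   components in all other charts are set to 0 so that equality of tangent
   vectors is equality of components. *)
Record tangent (p : M) := Tangent {
  components :> chart R n M -> 'cV[R]_n;
  components_out : forall c, ~ chart_at p c -> components c = 0;
  components_change : forall c d, chart_at p c -> chart_at p d ->
    components d = jac (transition c d) (c p) *m components c }.

Lemma tangentP p (v w : tangent p) : v =1 w -> v = w.
Proof.
case: v => v v1 v2; case: w => w w1 w2 /= /funext vw.
by subst w; congr Tangent; exact: Prop_irrelevance.
Qed.

HB.instance Definition _ p := gen_eqMixin (tangent p).
HB.instance Definition _ p := gen_choiceMixin (tangent p).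

Definition tangent0 p : tangent p.
Proof.
by exists (fun=> 0) => [//|c d _ _]; rewrite mulmx0.
Defined.

Definition tangentN p (v : tangent p) : tangent p.
Proof.
exists (fun c => - v c) => [c /components_out ->|c d pc pd].
  by rewrite oppr0.
by rewrite (components_change v pc pd) mulmxN.
Defined.

Definition tangentD p (v w : tangent p) : tangent p.
Proof.
exists (fun c => v c + w c) => [c pc|c d pc pd].
  by rewrite !components_out // addr0.
by rewrite (components_change v pc pd) (components_change w pc pd) mulmxDr.
Defined.

Definition tangentZ p (a : R) (v : tangent p) : tangent p.
Proof.
exists (fun c => a *: v c) => [c /components_out ->|c d pc pd].
  by rewrite scaler0.
by rewrite (components_change v pc pd) scalemxAr.
Defined.

Fact tangent_addA p : associative (@tangentD p).
Proof. by move=> u v w; apply: tangentP => c /=; rewrite addrA. Qed.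
Fact tangent_addC p : commutative (@tangentD p).
Proof. by move=> u v; apply: tangentP => c /=; rewrite addrC. Qed.
Fact tangent_add0 p : left_id (tangent0 p) (@tangentD p).
Proof. by move=> u; apply: tangentP => c /=; rewrite add0r. Qed.
Fact tangent_addN p : left_inverse (tangent0 p) (@tangentN p) (@tangentD p).
Proof. by move=> u; apply: tangentP => c /=; rewrite addNr. Qed.

HB.instance Definition _ p := GRing.isZmodule.Build (tangent p)
  (@tangent_addA p) (@tangent_addC p) (@tangent_add0 p) (@tangent_addN p).

Fact tangent_scaleA p (a b : R) (v : tangent p) :
  tangentZ a (tangentZ b v) = tangentZ (a * b) v.
Proof. by apply: tangentP => c /=; rewrite scalerA. Qed.
Fact tangent_scale1 p : left_id 1 (@tangentZ p).
Proof. by move=> u; apply: tangentP => c /=; rewrite scale1r. Qed.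
Fact tangent_scaleDr p : right_distributive (@tangentZ p) +%R.
Proof. by move=> a u v; apply: tangentP => c /=; rewrite scalerDr. Qed.
Fact tangent_scaleDl p (v : tangent p) :
  {morph (@tangentZ p)^~ v : a b / a + b}.
Proof. by move=> a b; apply: tangentP => c /=; rewrite scalerDl. Qed.

HB.instance Definition _ p := GRing.Zmodule_isLmodule.Build R (tangent p)
  (@tangent_scaleA p) (@tangent_scale1 p) (@tangent_scaleDr p)
  (@tangent_scaleDl p).

Lemma nbhs_chart_dom p c : chart_dom c p -> nbhs p (chart_dom c).
Proof. by move=> cp; apply: open_nbhs_nbhs; split => //; exact: chart_dom_open. Qed.

Lemma nbhs_chart_cod p c : chart_dom c p -> nbhs (c p) (chart_cod c).
Proof.
move=> cp; apply: open_nbhs_nbhs; split; first exact: chart_cod_open.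
by exists p.
Qed.

Lemma near_chart_inv p c (U : set M) : chart_dom c p -> nbhs p U ->
  \forall x \near c p, U (chart_inv c x).
Proof.
move=> cp Up; have := @chart_inv_continuous _ _ _ c.
rewrite continuous_open_subspace; last exact: chart_cod_open.
move/(_ (c p)); rewrite inE => /(_ (ex_intro2 _ _ p cp erefl)).
by rewrite /continuous_at chart_mapK //; exact.
Qed.

Lemma jac_transition_comp p c d e :
  chart_at p c -> chart_at p d -> chart_at p e ->
  jac (transition c e) (c p) =
  jac (transition d e) (d p) *m jac (transition c d) (c p).
Proof.
move=> [ac cp] [ad dp] [ae ep].
have sm f g : atlas f -> atlas g -> chart_dom f p -> chart_dom g p ->
    differentiable (transition f g) (f p).
  move=> af ag fp gp; have [+ _] := atlas_compatible af ag.
  by move/(_ [::] (f p)); apply; exists p.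
have cdp : transition c d (c p) = d p by rewrite /transition /= chart_mapK.
have dcd := sm _ _ ac ad cp dp.
have dde := sm _ _ ad ae dp ep.
have dde' : differentiable (transition d e) (transition c d (c p)).
  by rewrite cdp.
have -> : jac (transition c e) (c p) =
    jac (transition d e \o transition c d) (c p).
  apply: near_jac; near=> x; rewrite /transition /= chart_mapK //.
  near: x; exact: near_chart_inv (nbhs_chart_dom dp).
apply/matrixP => i j; have := @jacE R n _ _ (basis_vec j)
  (differentiable_comp dcd dde').
rewrite diff_comp // /= cdp -!jacE // mulmxA => /matrixP/(_ i 0).
by rewrite /basis_vec -!colE !mxE.
Unshelve. all: by end_near. Qed.

Definition tvec_comp p c (y : 'cV[R]_n) d : 'cV[R]_n :=
  if `[< chart_at p c /\ chart_at p d >]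
  then jac (transition c d) (c p) *m y else 0.

Fact tvec_out p c y d : ~ chart_at p d -> tvec_comp p c y d = 0.
Proof. by move=> pd; rewrite /tvec_comp; case: asboolP => // -[]. Qed.

Fact tvec_change p c y d e : chart_at p d -> chart_at p e ->
  tvec_comp p c y e = jac (transition d e) (d p) *m tvec_comp p c y d.
Proof.
move=> pd pe; rewrite /tvec_comp; case: asboolP => [[pc _]|Npc].
  rewrite ifT; last exact/asboolP.
  by rewrite (jac_transition_comp pc pd pe) mulmxA.
rewrite ifF ?mulmx0 //; apply/asboolP => -[pc _]; exact: Npc.
Qed.

(* y^i d/dx^i at p, in the coordinates of a chart c around p *)
Definition tvec p c (y : 'cV[R]_n) : tangent p :=
  Tangent (@tvec_out p c y) (@tvec_change p c y).

End Tangent.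
Arguments tangent {R n} M p.
Arguments tvec {R n M} p c y.

(* Natural coordinates (x, y) = (x^i, y^i) on the tangent bundle are pairs of
   columns; a tangent vector of the tangent bundle at (x, y), with components
   v^i on d/dx^i and w^i on d/dy^i, is the pair (v, w). *)
Section Coordinates.
Context {R : realType} {n : nat} {M : manifold R n}.
Implicit Types (c d : chart R n M) (u V : 'cV[R]_n * 'cV[R]_n).

Definition d_x (i : 'I_n) (f : 'cV[R]_n * 'cV[R]_n -> R) u : R :=
  'D_(basis_vec i, 0 : 'cV[R]_n) f u.

Definition d_y (i : 'I_n) (f : 'cV[R]_n * 'cV[R]_n -> R) u : R :=
  'D_(0 : 'cV[R]_n, basis_vec i) f u.

(* the part of N = TM \ 0 over the domain of c, in natural coordinates *)
Definition slit c : set ('cV[R]_n * 'cV[R]_n) :=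
  [set u | chart_cod c u.1 /\ u.2 != 0].

Definition tangent_transition c d u : 'cV[R]_n * 'cV[R]_n :=
  (transition c d u.1, jac (transition c d) u.1 *m u.2).

End Coordinates.

Section Finsler.
Context {R : realType} {n : nat} {M : manifold R n}.
Variable F : forall p : M, tangent M p -> R.
Implicit Types (c : chart R n M) (u V : 'cV[R]_n * 'cV[R]_n) (i j k : 'I_n).

Definition local_F c u : R := F (tvec (chart_inv c u.1) c u.2).

Definition fundamental c u : 'M[R]_n :=
  \matrix_(i, j) (2^-1 * d_y i (d_y j (fun z => local_F c z ^+ 2)) u).

Definition finsler : Prop :=
  [/\ forall p (y : tangent M p), 0 <= F y,
      forall c, atlas c -> smooth_on (slit c) (local_F c),
      forall p (y : tangent M p) (lambda : R), 0 < lambda ->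
        F (lambda *: y) = lambda * F y
    & forall c u, atlas c -> slit c u ->
        forall v : 'cV[R]_n, v != 0 -> 0 < (v^T *m fundamental c u *m v) 0 0].

Definition indicatrix (p : M) : set (tangent M p) := [set y | F y = 1].

Definition g_low c i j u : R := fundamental c u i j.
Definition g_up c i j u : R := invmx (fundamental c u) i j.

Definition cartan c i j k u : R := local_F c u / 2 * d_y k (g_low c i j) u.

Definition cartan_up c i j k u : R :=
  \sum_s g_up c i s u * cartan c s j k u.

Definition formal_christoffel c i j k u : R :=
  2^-1 * \sum_s g_up c i s u *
    (d_x k (g_low c s j) u - d_x s (g_low c j k) u + d_x j (g_low c s k) u).

Definition nonlinear_connection c i j u : R :=
  \sum_k formal_christoffel c i j k u * u.2 k 0
  - (local_F c u)^-1 * \sum_k \sum_r \sum_s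
      cartan_up c i j k u * formal_christoffel c k r s u * u.2 r 0 * u.2 s 0.

(* the one-form delta y^i = dy^i + N^i_j dx^j *)
Definition delta_y c i u V : R :=
  V.2 i 0 + \sum_j nonlinear_connection c i j u * V.1 j 0.

End Finsler.
Arguments indicatrix {R n M} F p.

(* A linear connection on the pull-back bundle pi^*TM -> N, given by its matrices
   of connection one-forms w^i_j in the natural frames d/dx^i. The last axiom is
   the change of frame formula dJ + w' J = J w. *)
Record pullback_connection (R : realType) (n : nat) (M : manifold R n) :=
  PullbackConnection {
  pform : chart R n M -> 'cV[R]_n * 'cV[R]_n -> 'cV[R]_n * 'cV[R]_n -> 'M[R]_n;
  pform_linear : forall c u, atlas c -> slit c u -> linear (pform c u);
  pform_smooth : forall c V, atlas c ->
    smooth_on (slit c) (fun u => pform c u V);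
  pform_change : forall c d u V, atlas c -> atlas d -> slit c u ->
    overlap c d u.1 ->
    let J := jac (transition c d) in
    let T := tangent_transition c d in
    'D_V (fun z => J z.1) u + pform d (T u) ('D_V T u) *m J u.1
    = J u.1 *m pform c u V }.

Section Chern.
Context {R : realType} {n : nat} {M : manifold R n}.
Variable F : forall p : M, tangent M p -> R.

(* D is the Chern connection of F, with w^i_j = Gamma^i_jk(x, y) dx^k. *)
Definition chern_connection (D : pullback_connection M)
    (Gamma : chart R n M -> 'I_n -> 'I_n -> 'I_n ->
             'cV[R]_n * 'cV[R]_n -> R) : Prop :=
  forall c u, atlas c -> slit c u ->
  let g := fundamental F c in
  let w := pform D c u in
  [/\ forall V i j, w V i j = \sum_k Gamma c i j k u * V.1 k 0,
      forall i j k, Gamma c i j k u = Gamma c i k j u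
    & forall V i j,
        'D_V (fun z => g z i j) u
          - \sum_k g u k j * w V k i - \sum_k g u i k * w V k j
        = 2 * \sum_k cartan F c i j k u * delta_y F c k u V / local_F F c u].

(* The Chern connection being unique, "its coefficients do not depend on y" is
   stated existentially. *)
Definition berwald : Prop :=
  exists D Gamma, chern_connection D Gamma /\
    forall c i j k (x y y' : 'cV[R]_n), atlas c ->
      slit c (x, y) -> slit c (x, y') ->
      Gamma c i j k (x, y) = Gamma c i j k (x, y').

End Chern.

(* A linear connection on TM -> M, given by its matrices of connection one-forms
   in the natural frames. *)
Record affine_connection (R : realType) (n : nat) (M : manifold R n) :=
  AffineConnection {
  aform : chart R n M -> 'cV[R]_n -> 'cV[R]_n -> 'M[R]_n;
  aform_linear : forall c x, atlas c -> chart_cod c x -> linear (aform c x);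
  aform_smooth : forall c v, atlas c ->
    smooth_on (chart_cod c) (fun x => aform c x v);
  aform_change : forall c d x v, atlas c -> atlas d -> overlap c d x ->
    let t := transition c d in
    let J := jac t in
    'D_v J x + aform d (t x) (J x *m v) *m J x = J x *m aform c x v }.

Section Riemann.
Context {R : realType} {n : nat} {M : manifold R n}.
Variable h : forall p : M, tangent M p -> tangent M p -> R.

Definition local_metric (c : chart R n M) (x : 'cV[R]_n) : 'M[R]_n :=
  let p := chart_inv c x in
  \matrix_(i, j) h (tvec p c (basis_vec i)) (tvec p c (basis_vec j)).

Definition riemannian : Prop :=
  [/\ forall p (v : tangent M p), scalar (h v),
      forall p (v w : tangent M p), h v w = h w v,
      forall p (v : tangent M p), v != 0 -> 0 < h v v
    & forall c, atlas c -> smooth_on (chart_cod c) (local_metric c)].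

Definition levi_civita (D : affine_connection M) : Prop :=
  forall c x, atlas c -> chart_cod c x ->
  [/\ forall v w, aform D c x v *m w = aform D c x w *m v
    & forall v, 'D_v (local_metric c) x =
        (aform D c x v)^T *m local_metric c x
        + local_metric c x *m aform D c x v].

End Riemann.

Section ParallelTransport.
Context {R : realType} {n : nat} {M : manifold R n}.

(* gamma is a smooth path on [a, b], i.e. on some open set containing [a, b];
   its values elsewhere are irrelevant. *)
Definition smooth_path (gamma : R -> M) (a b : R) : Prop :=
  exists U : set R, [/\ open U, `[a, b] `<=` U,
    forall t, U t -> {for t, continuous gamma}
    & forall c, atlas c ->
        smooth_on (U `&` gamma @^-1` chart_dom c) (c \o gamma)].

(* dX^i/dt + w^i_j(gamma') X^j = 0. Derivatives at a and b are two-sided: by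
   linearity of the equation, a parallel field on [a, b] extends along the
   extension of gamma. *)
Definition parallel (D : affine_connection M) (gamma : R -> M) (a b : R)
    (X : forall t, tangent M (gamma t)) : Prop :=
  forall t c, t \in `[a, b] -> chart_at (gamma t) c ->
    is_derive t 1 (fun s => X s c)
      (- (aform D c (c (gamma t)) ('D_1 (c \o gamma) t) *m X t c)).

(* the graph of parallel transport along gamma from gamma a to gamma b *)
Definition parallel_transport (D : affine_connection M) (gamma : R -> M)
    (a b : R) (y : tangent M (gamma a)) (z : tangent M (gamma b)) : Prop :=
  exists X : forall t, tangent M (gamma t),
    [/\ parallel D a b X, X a = y & X b = z].

End ParallelTransport.

(* Main.v *)
Require Import Defs.
From HB Require Import structures.
From mathcomp Require Import all_boot all_order all_algebra.
From mathcomp Require Import all_classical all_reals all_analysis.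
From mathcomp Require Import ring.
Import Order.TTheory GRing.Theory Num.Theory.
Import numFieldNormedType.Exports.

Set Implicit Arguments.
Unset Strict Implicit.
Unset Printing Implicit Defensive.

Local Open Scope classical_set_scope.
Local Open Scope ring_scope.

(** The Levi-Civita connection of h, pulled back to the slit tangent bundle, is
    the Chern connection of F; its coefficients are functions on M, so F is
    Berwald. Write A_v(x) for the matrix of the connection form of h on the
    vector v.

    If parallel transport preserves the indicatrix, F is constant along parallel
    fields on the indicatrix. Infinitesimally, along a coordinate line of
    direction v, this says that F has derivative 0 at (x, y) in the direction
    (v, - A_v(x) y) ([derive_local_F_indicatrix]). By homogeneity the equation
    holds at every y <> 0 ([derive_local_F_horizontal]), and F^2 satisfies it as
    well. Since A_v(x) does not depend on y, two derivatives in y turn it into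
    an equation for the fundamental tensor ([d_x_g_low]): with A_k for the matrix
    of d/dx^k, dg_ij/dx^k is the sum of the two terms in A_k of metric
    compatibility and of the derivative of g_ij in the fibre direction A_k y.
    This step exchanges derivatives of smooth functions ([derive_swap]).

    The last term contains A_k y where the Chern connection has the nonlinear
    connection N of F. The two agree ([nonlinear_connectionE]): insert the
    equation for dg in the formal Christoffel symbols, use that A is torsion free
    and that the Cartan tensor is symmetric and vanishes on y; what the
    Christoffel symbols have in excess of A is cancelled, after contraction with
    y, by the Cartan term in the definition of N. So the pulled back connection
    satisfies both structure equations ([chern_connection_pullback]). *)

(** * Directional derivatives along lines and affine maps *)

Section Derivatives.
Context {R : realType}.
Implicit Types V W : normedModType R.

(** A directional derivative only sees the line through [x]. This allows
    functions that agree on one fibre of the tangent bundle, and not near the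
    point, to be differentiated along that fibre. *)
Lemma derive_eq_line V W (f g : V -> W) (x v : V) :
  (\forall h \near (0 : R), f (h *: v + x) = g (h *: v + x)) ->
  'D_v f x = 'D_v g x.
Proof.
move=> fg; have fgx : f x = g x.
  by have := nbhs_singleton fg; rewrite scale0r add0r.
have E : \forall h \near (0 : R), h^-1 *: ((f \o shift x) (h *: v) - f x) =
                          h^-1 *: ((g \o shift x) (h *: v) - g x).
  by apply: filterS fg => h /= ->; rewrite fgx.
rewrite /derive; congr (lim _).
rewrite eqEsubset; split; apply/near_eq_cvg/cvg_within => //.
by apply: filterS E.
Qed.

(** The difference quotients on the two sides coincide. *)
Lemma derive_comp_affine V V' W (L A : V -> V') (f : V' -> W) v :
  (forall (h : R) w x, A (h *: w + x) = h *: L w + A x) ->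
  forall x, 'D_v (f \o A) x = 'D_(L v) f (A x).
Proof. by move=> AL x; rewrite /derive /=; under eq_fun do rewrite AL. Qed.

Lemma iter_derive_comp_affine V V' W (L A : V -> V') (f : V' -> W) vs :
  (forall (h : R) w x, A (h *: w + x) = h *: L w + A x) ->
  iter_derive vs (f \o A) = iter_derive (map L vs) f \o A.
Proof.
move=> AL; elim: vs => //= v vs IH; apply/funext => x.
by rewrite -/(iter_derive vs _) IH (derive_comp_affine _ _ AL).
Qed.

Lemma smooth_on_comp_affine V V' W (L A : V -> V') (f : V' -> W) U :
  (forall (h : R) w x, A (h *: w + x) = h *: L w + A x) ->
  (forall x, differentiable A x) ->
  smooth_on U f -> smooth_on (A @^-1` U) (f \o A).
Proof.
move=> AL dA sf vs x Ux; rewrite (iter_derive_comp_affine _ _ AL).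
by apply: differentiable_comp => //; exact: sf.
Qed.

Lemma line_affine V (v x : V) (h s t : R) :
  (h *: s + t) *: v + x = h *: (s *: v) + (t *: v + x).
Proof. by rewrite scalerDl addrA scalerA. Qed.

Lemma derive_line V (v x : V) t :
  'D_1 (fun t : R => t *: v + x) t = v.
Proof.
rewrite (derive_comp_affine (L := fun s : R => s *: v)
  (A := fun t : R => t *: v + x) id).
  by rewrite scale1r derive_id.
by move=> h s r; exact: line_affine.
Qed.

Lemma deriveDl V W (f : V -> W) x v w : differentiable f x ->
  'D_(v + w) f x = 'D_v f x + 'D_w f x.
Proof. by move=> df; rewrite !deriveE // linearD. Qed.

Lemma deriveZl V W (f : V -> W) x (a : R) v : differentiable f x ->
  'D_(a *: v) f x = a *: 'D_v f x.
Proof. by move=> df; rewrite !deriveE // linearZ. Qed.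

Lemma derive_comp V V' W (f : V -> V') (g : V' -> W) x v :
  differentiable f x -> differentiable g (f x) ->
  'D_v (g \o f) x = 'D_('D_v f x) g (f x).
Proof.
move=> df dg; rewrite !deriveE //; first by rewrite diff_comp.
exact: differentiable_comp.
Qed.

Lemma near_line V (U : set V) x v : nbhs x U ->
  \forall h \near (0 : R), U (h *: v + x).
Proof.
move=> Ux; have : {for (0 : R), continuous (fun h : R => h *: v + x)}.
  exact: differentiable_continuous.
by move=> C; have := C U; rewrite scale0r add0r; exact.
Qed.

Lemma is_derive_affine V W (f : V -> W) (x v : V) (d : W) :
  (forall h : R, f (h *: v + x) = h *: d + f x) -> is_derive x v f d.
Proof.
move=> fd; have near_d : \forall h \near (0 : R)^',
    h^-1 *: ((f \o shift x) (h *: v) - f x) = d.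
  by exists 1 => //= h _ h0; rewrite fd addrK scalerA mulVf // scale1r.
by apply: DeriveDef; [exact: is_cvg_near_cst near_d | exact: lim_near_cst near_d].
Qed.

Lemma derive_pair V W W' (f : V -> W) (g : V -> W') x v :
  derivable f x v -> derivable g x v ->
  'D_v (fun y => (f y, g y)) x = ('D_v f x, 'D_v g x).
Proof. by move=> df dg; apply: cvg_lim => //; exact: cvg_pair df dg. Qed.

(** The difference [g - f] vanishes near [x], so it has differential 0 there. *)
Lemma near_eq_differentiable V W (f g : V -> W) x :
  (\near x, f x = g x) -> differentiable f x -> differentiable g x.
Proof.
move=> fg df; have -> : g = f + (g - f) by rewrite addrC subrK.
apply: differentiableD => //.
have k0 : (g - f) \o shift x = cst ((g - f) x) + \0 +o_ 0 id.
  apply/eqaddoP => e e0; rewrite !near_simpl.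
  have : \forall h \near (0 : V), f (h + x) = g (h + x).
    by have := fg; rewrite (near_shift 0 x) subr0.
  apply: filterS => h /= fgh.
  rewrite !fctE /= fgh (nbhs_singleton fg) !subrr addr0 subrr normr0.
  by rewrite mulr_ge0 // ltW.
have c0 : continuous (\0 : V -> W) by move=> ?; exact: cst_continuous.
by apply/diff_locallyP; have -> := diff_unique c0 k0.
Qed.

(** Differentiability at [x] makes the left derivative the derivative; this is
    what turns information on the past of a path into a derivative at its end
    point. *)
Lemma derive_left_cst (f : R -> R) (x e : R) : 0 < e ->
  differentiable f x -> (forall t, x - e < t <= x -> f t = f x) -> 'D_1 f x = 0.
Proof.
move=> e0 df fx; have dv : derivable f x 1 by exact: diff_derivable.
have E := cvg_at_leftE _ _ dv.
rewrite /derive E; apply/lim_near_cst => //.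
near=> h; suff -> : (f \o shift x) (h *: 1) = f x by rewrite subrr scaler0.
rewrite /= [h *: 1]mulr1 addrC; apply: fx; apply/andP; split.
  rewrite ltrD2l ltrNl; near: h.
  exists e => //= h; rewrite /= sub0r normrN => he h0.
  by rewrite -ltr0_norm.
by rewrite gerDl; near: h; exists 1 => //= h _ /ltW.
Unshelve. all: by end_near. Qed.

(** * Smooth functions on an open set *)

Lemma smooth_on_derive V W (U : set V) (f : V -> W) v :
  smooth_on U f -> smooth_on U ('D_v f).
Proof.
by move=> sf vs x Ux; have := sf (rcons vs v) x Ux; rewrite /iter_derive foldr_rcons.
Qed.

Lemma smooth_on_differentiable V W (U : set V) (f : V -> W) x :
  smooth_on U f -> U x -> differentiable f x.
Proof. by move=> sf Ux; exact: (sf [::]). Qed.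

Lemma smooth_on_continuous V W (U : set V) (f : V -> W) x :
  smooth_on U f -> U x -> {for x, continuous f}.
Proof. by move=> sf Ux; exact/differentiable_continuous/(smooth_on_differentiable sf). Qed.

Lemma near_open V (U : set V) (P : V -> Prop) x :
  open U -> U x -> (forall z, U z -> P z) -> \near x, P x.
Proof. by move=> oU Ux UP; apply: filterS UP _; exact: open_nbhs_nbhs. Qed.

Lemma eq_iter_derive V W (U : set V) (f g : V -> W) vs :
  open U -> {in U, f =1 g} -> {in U, iter_derive vs f =1 iter_derive vs g}.
Proof.
move=> oU fg; elim: vs => //= v vs IH x; rewrite inE => Ux.
apply: near_eq_derive; apply: (near_open oU Ux) => z Uz.
by apply: IH; rewrite inE.
Qed.

(** The derivative of a product of two smooth functions is a sum of such
    products, so an induction on the number of derivatives needs a class of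
    functions that is stable under sums as well. This class is stable under
    directional derivatives and consists of differentiable functions, hence of
    smooth ones. *)
Inductive smooth_closure V (U : set V) : (V -> R) -> Prop :=
| closure_smooth f : smooth_on U f -> smooth_closure U f
| closure_add f g : smooth_closure U f -> smooth_closure U g ->
    smooth_closure U (f + g)
| closure_mul f g : smooth_closure U f -> smooth_closure U g ->
    smooth_closure U (f * g)
| closure_eq f g : smooth_closure U f -> {in U, f =1 g} -> smooth_closure U g.

Lemma smooth_closure_differentiable V (U : set V) f x :
  open U -> smooth_closure U f -> U x -> differentiable f x.
Proof.
move=> oU sf Ux; elim: sf => {f} [f sf|f g _ df _ dg|f g _ df _ dg|f g _ df fg].
- exact: smooth_on_differentiable sf Ux.
- exact: differentiableD.
- exact: differentiableM.
- apply: near_eq_differentiable df; apply: (near_open oU Ux) => z Uz.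
  by rewrite fg // inE.
Qed.

Lemma smooth_closure_derive V (U : set V) f v :
  open U -> smooth_closure U f -> smooth_closure U ('D_v f).
Proof.
move=> oU; have D g z : smooth_closure U g -> z \in U -> derivable g z v.
  rewrite inE => sg Uz; apply/diff_derivable.
  exact: smooth_closure_differentiable sg Uz.
elim=> {f} [f sf|f g sf sdf sg sdg|f g sf sdf sg sdg|f g sf sdf fg].
- exact/closure_smooth/smooth_on_derive.
- apply: closure_eq (closure_add sdf sdg) _ => z Uz.
  by rewrite deriveD //; exact: D.
- apply: closure_eq (closure_add (closure_mul sf sdg) (closure_mul sg sdf)) _ => z Uz.
  by rewrite deriveM //; exact: D.
- apply: closure_eq sdf _ => z; rewrite inE => Uz.
  by apply: near_eq_derive; apply: (near_open oU Uz) => y Uy; rewrite fg // inE.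
Qed.

Lemma smooth_onM V (U : set V) (f g : V -> R) :
  open U -> smooth_on U f -> smooth_on U g -> smooth_on U (f * g).
Proof.
move=> oU sf sg vs x Ux.
apply: (smooth_closure_differentiable oU _ Ux).
elim: vs => [|v vs IH] /=; last exact: smooth_closure_derive.
by apply: closure_mul; exact: closure_smooth.
Qed.

(** * Symmetry of second derivatives *)

Lemma is_derive_line V W (f : V -> W) (a v : V) (s : R) :
  differentiable f (s *: v + a) ->
  is_derive s 1 (fun t : R => f (t *: v + a)) ('D_v f (s *: v + a)).
Proof.
move=> df.
have A (h w x : R) : (h *: w + x) *: v + a = h *: (w *: v) + (x *: v + a).
  exact: line_affine.
apply: DeriveDef; last first.
  rewrite (derive_comp_affine (L := fun w : R => w *: v)
    (A := fun t : R => t *: v + a) f 1 A).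
  by rewrite scale1r.
apply/derivable1_diffP; apply: (differentiable_comp (f := fun t : R => t *: v + a)) => //.
Qed.

Lemma MVT_line V (f : V -> R) (a v : V) (h : R) : 0 < h ->
  (forall s : R, 0 <= s <= h -> differentiable f (s *: v + a)) ->
  exists2 s, 0 < s < h & f (h *: v + a) - f a = 'D_v f (s *: v + a) * h.
Proof.
move=> h0 df.
have [||s sh] := @MVT R (fun t : R => f (t *: v + a))
  (fun t => 'D_v f (t *: v + a)) 0 h h0.
- move=> s; rewrite in_itv /= => /andP[/ltW s0 /ltW sh]; apply: is_derive_line.
  by apply: df; rewrite s0.
- apply: derivable_within_continuous => s; rewrite in_itv /= => sh.
  by have [] := is_derive_line (df s sh).
rewrite scale0r add0r subr0 => E; exists s => //.
Qed.

Lemma near_parallelogram V (v w x : V) (U : set V) : nbhs x U ->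
  exists2 d : R, 0 < d & forall s t, 0 <= s <= d -> 0 <= t <= d ->
    U (s *: v + (t *: w + x)).
Proof.
case/nbhs_normP => r /= r0 rU.
have N : 0 < `|v| + `|w| + 1 by rewrite ltr_wpDl // addr_ge0.
exists (r / (`|v| + `|w| + 1)); first exact: divr_gt0.
move=> s t /andP[s0 sd] /andP[t0 td]; apply: rU => /=.
rewrite addrA opprD addrCA subrr addr0 normrN.
apply: (le_lt_trans (ler_normD _ _)); rewrite !normrZ !ger0_norm //.
apply: (@le_lt_trans _ _ (r / (`|v| + `|w| + 1) * (`|v| + `|w|))).
  by rewrite mulrDr lerD // ler_wpM2r.
by rewrite -mulrA gtr_pMr // mulrC ltr_pdivrMr // mul1r ltrDl.
Qed.

(** Applying the mean value theorem to the two sides in turn turns the second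
    difference of [f] over a small parallelogram into a second derivative at a
    point of the parallelogram. *)
Lemma second_difference V (U : set V) (f : V -> R) (v w x : V) (h : R) :
  smooth_on U f -> 0 < h ->
  (forall s t, 0 <= s <= h -> 0 <= t <= h -> U (s *: v + (t *: w + x))) ->
  exists s t, [/\ 0 <= s <= h, 0 <= t <= h &
    f (h *: v + (h *: w + x)) - f (h *: v + x) - (f (h *: w + x) - f x)
    = 'D_w ('D_v f) (s *: v + (t *: w + x)) * h ^+ 2].
Proof.
move=> sf h0 hU; have hh : 0 <= h <= h by rewrite ltW /=.
have h00 : 0 <= (0 : R) <= h by rewrite lexx ltW.
pose g z := f (h *: w + z) - f z.
have U0 s : 0 <= s <= h -> U (s *: v + x).
  by move=> sh; have := hU s 0 sh h00; rewrite scale0r add0r.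
have U1 s : 0 <= s <= h -> U (h *: w + (s *: v + x)).
  by move=> sh; have := hU s h sh hh; rewrite addrCA.
have dS z : U (h *: w + z) -> differentiable (fun z => f (h *: w + z)) z.
  move=> Uz; apply: (differentiable_comp (f := fun z => h *: w + z)) => //.
  exact: smooth_on_differentiable sf _.
have [|s sh E] := @MVT_line V g x v h h0.
  move=> s sh; apply: differentiableB; first exact/dS/U1.
  by apply: smooth_on_differentiable sf _; exact: U0.
have {}sh : 0 <= s <= h by case/andP: sh => /ltW -> /ltW ->.
have gE : 'D_v g (s *: v + x) =
    'D_v f (h *: w + (s *: v + x)) - 'D_v f (s *: v + x).
  rewrite deriveB; last 2 first.
  - exact/diff_derivable/dS/U1.
  - exact/diff_derivable/(smooth_on_differentiable sf)/U0.
  congr (_ - _); apply: (derive_comp_affine (L := id) (A := fun z => h *: w + z)).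
  by move=> k y z /=; rewrite addrCA.
have [|t th E'] := @MVT_line V ('D_v f) (s *: v + x) w h h0.
  move=> t th; apply: (smooth_on_differentiable (smooth_on_derive v sf)).
  by rewrite addrCA; exact: hU.
exists s, t; split => //; first by case/andP: th => /ltW -> /ltW ->.
move: E; rewrite /g gE E' (addrCA (h *: w) (h *: v)) => ->.
by rewrite addrCA expr2 mulrA.
Qed.

(** The second difference over the parallelogram of sides [h *: v] and [h *: w]
    is symmetric in [v] and [w], and divided by [h ^+ 2] it is close to either of
    the two mixed derivatives, by their continuity. *)
Lemma derive_swap V (U : set V) (f : V -> R) (v w x : V) :
  open U -> smooth_on U f -> U x -> 'D_v ('D_w f) x = 'D_w ('D_v f) x.
Proof.
move=> oU sf Ux; apply/eqP; rewrite -subr_eq0 -normr_le0; apply/ler_addgt0Pl => e e0.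
rewrite addr0; have e20 : 0 < e / 2 by rewrite divr_gt0.
have C a b : nbhs x [set z | U z /\ `|'D_a ('D_b f) x - 'D_a ('D_b f) z| < e / 2].
  apply: filterI; first exact: open_nbhs_nbhs.
  have := smooth_on_continuous (smooth_on_derive a (smooth_on_derive b sf)) Ux.
  by move/cvgrPdist_lt; exact.
have [d1 d10 H1] := near_parallelogram v w (C w v).
have [d2 d20 H2] := near_parallelogram w v (C v w).
pose h := Num.min d1 d2; have h0 : 0 < h by rewrite lt_min d10.
have hd1 s : 0 <= s <= h -> 0 <= s <= d1.
  by case/andP=> ->; rewrite /h le_min => /andP[].
have hd2 s : 0 <= s <= h -> 0 <= s <= d2.
  by case/andP=> ->; rewrite /h le_min => /andP[].
have [|s1 [t1 [/hd1 s1h /hd1 t1h E1]]] := second_difference (v := v) (w := w) (x := x) sf h0.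
  by move=> s t /hd1 sh /hd1 th; have [] := H1 s t sh th.
have [|s2 [t2 [/hd2 s2h /hd2 t2h E2]]] := second_difference (v := w) (w := v) (x := x) sf h0.
  by move=> s t /hd2 sh /hd2 th; have [] := H2 s t sh th.
have [_ /ltW B1] := H1 _ _ s1h t1h.
have [_ /ltW B2] := H2 _ _ s2h t2h.
have close (p q r1 r2 D1 D2 : R) : D1 = r1 * h ^+ 2 -> D2 = r2 * h ^+ 2 ->
    D1 = D2 -> `|q - r1| <= e / 2 -> `|p - r2| <= e / 2 -> `|p - q| <= e.
  move=> -> -> /(mulIf (lt0r_neq0 (exprn_gt0 2 h0))) -> qr pr.
  rewrite (splitr e) (le_trans _ (lerD pr qr)) //.
  by rewrite (distrC q r2); exact: ler_distD.
refine (close _ _ _ _ _ _ E1 E2 _ B1 B2).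
rewrite [in RHS]addrCA.
by rewrite !opprB addrACA [in RHS]addrACA [in RHS](addrC (- _) (- _)).
Qed.

End Derivatives.

(** * Charts, coordinate lines and components of tangent vectors *)

Section Coordinates.
Context {R : realType} {n : nat} {M : manifold R n}.
Implicit Types (p : M) (c d : chart R n M).

Lemma chart_invK c x : chart_cod c x ->
  chart_dom c (chart_inv c x) /\ c (chart_inv c x) = x.
Proof. by case=> p cp <-; rewrite chart_mapK. Qed.

Lemma open_slit c : open (slit c).
Proof.
apply: openI.
  apply: open_comp; last exact: chart_cod_open.
  by move=> u _; exact: cvg_fst.
apply: (@open_comp _ _ snd [set y : 'cV[R]_n | y != 0]).
  by move=> u _; exact: cvg_snd.
have -> : [set y : 'cV[R]_n | y != 0] = ~` [set 0].
  by apply/seteqP; split=> y /=; [move/eqP | move=> H; apply/eqP].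
exact/closed_openC/accessible_closed_set1/hausdorff_accessible/norm_hausdorff.
Qed.

(** The transition map of a chart to itself is the identity near each point. *)
Lemma tvec_self p c y : chart_at p c -> tvec p c y c = y.
Proof.
move=> pc; rewrite /= /tvec_comp ifT; last exact/asboolP.
have -> : jac (transition c c) (c p) = jac id (c p).
  apply: near_jac; apply: filterS (nbhs_chart_cod pc.2) => x cx.
  by rewrite /transition /= (chart_invK cx).2.
have -> : jac id (c p) = 1%:M; last by rewrite mul1mx.
by apply/matrixP => i j; rewrite !mxE derive_id mxE eqxx andbT.
Qed.

Lemma tvec_components p c (X : tangent M p) : chart_at p c -> tvec p c (X c) = X.
Proof.
move=> pc; apply: tangentP => d /=; rewrite /tvec_comp; case: asboolP.
  by move=> [_ pd]; rewrite -components_change.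
by move=> H; rewrite components_out // => pd; apply: H.
Qed.

Lemma tvecZ p c (a : R) y : tvec p c (a *: y) = a *: tvec p c y.
Proof.
apply: tangentP => d /=; rewrite /tvec_comp; case: asboolP => _.
  by rewrite scalemxAr.
by rewrite scaler0.
Qed.

Lemma open_line_chart c (v x : 'cV[R]_n) :
  open [set t : R | chart_cod c (t *: v + x)].
Proof.
apply: open_comp; last exact: chart_cod_open.
by move=> t _; exact: differentiable_continuous.
Qed.

Lemma smooth_coordinate_line c (v x : 'cV[R]_n) (a b : R) : atlas c ->
  (forall t, t \in `[a, b] -> chart_cod c (t *: v + x)) ->
  smooth_path (fun t => chart_inv c (t *: v + x)) a b.
Proof.
move=> ac abc; exists [set t : R | chart_cod c (t *: v + x)]; split.
- exact: open_line_chart.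
- exact: abc.
- move=> t ct; have := @chart_inv_continuous _ _ _ c.
  rewrite continuous_open_subspace; last exact: chart_cod_open.
  move/(_ (t *: v + x)); rewrite inE => /(_ ct) C.
  apply: (@continuous_comp _ _ _ (fun t : R => t *: v + x) (chart_inv c)) => //.
  exact: differentiable_continuous.
- move=> d ad vs t [/= ct dt].
  have [sm _] := atlas_compatible ac ad.
  apply: (smooth_on_comp_affine (U := overlap c d) (L := fun s : R => s *: v)
    (A := fun t : R => t *: v + x) (f := transition c d)) => //.
    by move=> h s r; exact: line_affine.
  by have [cd E] := chart_invK ct; exists (chart_inv c (t *: v + x)).
Qed.

End Coordinates.

(** * Invariance of the indicatrix as a differential equation *)

Definition transport_invariant (R : realType) (n : nat) (M : manifold R n)
    (F : forall p : M, tangent M p -> R) (D : affine_connection M) : Prop :=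
  forall (gamma : R -> M) (a b : R), a < b -> smooth_path gamma a b ->
  [set z | exists2 y, indicatrix F (gamma a) y & parallel_transport D y z]
  = indicatrix F (gamma b).

Section Invariance.
Context {R : realType} {n : nat} {M : manifold R n}.
Variable F : forall p : M, tangent M p -> R.
Variable D : affine_connection M.
Hypothesis hF : finsler F.
Hypothesis invF : transport_invariant F D.
Implicit Types c : chart R n M.

Lemma finsler0 (p : M) : F (0 : tangent M p) = 0.
Proof.
case: hF => _ _ hom _; have := hom p 0 2 (ltr0Sn _ _); rewrite scaler0 => /eqP.
by rewrite mulr_natl mulr2n -subr_eq0 opprD addrA subrr sub0r oppr_eq0 => /eqP.
Qed.

Lemma local_F0 c x : local_F F c (x, 0) = 0.
Proof. by rewrite /local_F /= -(scale0r (0 : 'cV[R]_n)) tvecZ scale0r finsler0. Qed.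

Lemma local_FZ c x y (a : R) : 0 < a ->
  local_F F c (x, a *: y) = a * local_F F c (x, y).
Proof. by move=> a0; case: hF => _ _ hom _; rewrite /local_F tvecZ hom. Qed.

(** A vector [z] of the indicatrix at the end of the coordinate line of direction
    [v] is, since the transport along the line is onto, the end value of a
    parallel field [X] that starts in the indicatrix. Applied to the initial
    pieces of the line, the invariance puts every value of [X] in the
    indicatrix, so F is constant along [X]. The coordinate velocity of [X] at the
    end is given by the equation of parallel transport, and the chain rule
    yields the claim. *)
Lemma derive_local_F_indicatrix c (x v z : 'cV[R]_n) :
  atlas c -> chart_cod c x -> local_F F c (x, z) = 1 ->
  'D_(v, - (aform D c x v *m z)) (local_F F c) (x, z) = 0.
Proof.
move=> ac cx Fz.
pose gamma t := chart_inv c (t *: v + x).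
have [e e0 ec] : exists2 e : R, 0 < e & forall t : R, `|t| <= e -> chart_cod c (t *: v + x).
  have : nbhs (0 : R) [set t : R | chart_cod c (t *: v + x)].
    apply: open_nbhs_nbhs; split; first exact: open_line_chart.
    by rewrite /= scale0r add0r.
  case/nbhs_normP => r /= r0 rc; exists (r / 2); first exact: divr_gt0.
  move=> t tr; apply: rc; rewrite /= sub0r normrN (le_lt_trans tr) //.
  by rewrite ltr_pdivrMr // ltr_pMr // ltr1n.
have ec' b t : b <= 0 -> t \in `[- e, b] -> chart_cod c (t *: v + x).
  move=> b0; rewrite in_itv /= => /andP[et tb]; apply: ec.
  by rewrite ler0_norm ?(le_trans tb) // lerNl.
have sg b : b <= 0 -> smooth_path gamma (- e) b.
  by move=> b0; apply: smooth_coordinate_line => // t; exact: ec' b0.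
have ca t : `|t| <= e -> chart_at (gamma t) c /\ c (gamma t) = t *: v + x.
  by move=> /ec /chart_invK[? ?]; do 2?split.
have [ca0 cg0] := ca 0 (eq_ind_r (fun u => u <= e) (ltW e0) (normr0 _)).
rewrite scale0r add0r in cg0.
have x0 : 0 *: v + x = x by rewrite scale0r add0r.
have : indicatrix F (gamma 0) (tvec (gamma 0) c z).
  by rewrite /indicatrix /= -Fz /local_F /= /gamma x0.
have Ne0 : - e < 0 by rewrite oppr_lt0.
rewrite -(invF Ne0 (sg _ (lexx 0))) => -[y Fy [X [pX Xy Xz]]].
(* the restriction of X to [-e, t] is a parallel field from y to X t *)
have FX t : - e < t <= 0 -> F (X t) = 1.
  case/andP=> et t0; suff : indicatrix F (gamma t) (X t) by [].
  rewrite -(invF et (sg _ t0)); exists y => //; exists X; split => // s d sI.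
  apply: pX; move: sI; rewrite !in_itv /= => /andP[-> st].
  exact: le_trans st t0.
pose phi t := X t c.
have phi0 : phi 0 = z by rewrite /phi Xz tvec_self.
have : is_derive (0 : R) (1 : R) phi (- (aform D c x v *m z)).
  have := pX 0 c; rewrite in_itv /= lexx oppr_le0 ltW // => /(_ isT ca0).
  rewrite -/(phi 0) phi0 cg0; congr (is_derive _ _ _ (- (aform _ _ _ _ *m _))).
  have -> : 'D_1 (c \o gamma) 0 = 'D_1 (fun t : R => t *: v + x) 0.
    apply: near_eq_derive; apply: filterS (nbhs0_lt e0) => t /ltW te.
    by rewrite /= (ca t te).2.
  exact: derive_line.
move=> [dphi phi'].
pose kappa t := (t *: v + x, phi t).
have dk1 : differentiable (fun t : R => t *: v + x) 0 by [].
have dk2 : differentiable phi 0 by exact/derivable1_diffP.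
have dk : differentiable kappa 0 by exact: differentiable_pair.
have k0 : kappa 0 = (x, z) by rewrite /kappa phi0 x0.
have k' : 'D_1 kappa 0 = (v, - (aform D c x v *m z)).
  by rewrite (derive_pair (diff_derivable dk1) (diff_derivable dk2)) derive_line phi'.
have dF : differentiable (local_F F c) (kappa 0).
  rewrite k0; case: hF => _ sF _ _.
  apply: (smooth_on_differentiable (sF c ac)); split => //=.
  apply/eqP => z0; move: Fz; rewrite z0 local_F0 => /eqP.
  by rewrite eq_sym oner_eq0.
rewrite -k' -k0 -derive_comp //.
apply: (derive_left_cst e0); first exact: differentiable_comp.
have Fk t : - e < t <= 0 -> local_F F c (kappa t) = 1.
  move=> te; rewrite -(FX t te) /local_F /= tvec_components //.
  case/andP: te => et t0; have [] // := ca t.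
  by rewrite ler0_norm // lerNl ltW.
move=> t; rewrite sub0r => te; rewrite /= !Fk //.
by rewrite lexx Ne0.
Qed.

End Invariance.

(** * Partial derivatives in natural coordinates *)

Section PairCalculus.
Context {R : realType} {n : nat}.
Local Notation TU := ('cV[R]_n * 'cV[R]_n)%type.
Implicit Types (f : TU -> R) (u : TU) (i j k l : 'I_n).

Lemma basis_vecE (v : 'cV[R]_n) : v = \sum_i v i 0 *: basis_vec i.
Proof.
apply/matrixP => i k; rewrite (ord1 k) summxE (bigD1 i) //= big1 => [|j ji].
  by rewrite !mxE !eqxx mulr1 addr0.
by rewrite !mxE eq_sym (negbTE ji) mulr0.
Qed.

Lemma derive_d_x f u (v : 'cV[R]_n) : differentiable f u ->
  'D_(v, 0 : 'cV[R]_n) f u = \sum_i v i 0 * d_x i f u.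
Proof.
move=> df; have -> : (v, 0) = \sum_i v i 0 *: (basis_vec i, 0 : 'cV[R]_n) :> TU.
  apply: injective_projections; rewrite /= !(raddf_sum fst, raddf_sum snd) /=.
    exact: basis_vecE.
  by rewrite big1 // => i _; rewrite scaler0.
rewrite deriveE // linear_sum.
by apply: eq_bigr => i _; rewrite linearZ /= -deriveE.
Qed.

Lemma derive_d_y f u (w : 'cV[R]_n) : differentiable f u ->
  'D_(0 : 'cV[R]_n, w) f u = \sum_i w i 0 * d_y i f u.
Proof.
move=> df; have -> : (0, w) = \sum_i w i 0 *: (0 : 'cV[R]_n, basis_vec i) :> TU.
  apply: injective_projections; rewrite /= !(raddf_sum fst, raddf_sum snd) /=.
    by rewrite big1 // => i _; rewrite scaler0.
  exact: basis_vecE.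
rewrite deriveE // linear_sum.
by apply: eq_bigr => i _; rewrite linearZ /= -deriveE.
Qed.

Lemma derive_split f u (v w : 'cV[R]_n) : differentiable f u ->
  'D_(v, w) f u = 'D_(v, 0 : 'cV[R]_n) f u + 'D_(0 : 'cV[R]_n, w) f u.
Proof.
move=> df; have -> : (v, w) = (v, 0 : 'cV[R]_n) + (0 : 'cV[R]_n, w).
  by congr pair; rewrite /= ?addr0 ?add0r.
exact: deriveDl.
Qed.

Lemma mulmx_basis_vec m (A : 'M[R]_(m, n)) (i : 'I_m) k : (A *m basis_vec k) i 0 = A i k.
Proof. by rewrite -colE mxE. Qed.

Lemma is_derive_lincomb (a : 'I_n -> R) (f : 'I_n -> TU -> R) u e :
  (forall i, differentiable (f i) u) ->
  is_derive u e (fun z => \sum_i a i * f i z) (\sum_i a i * 'D_e (f i) u).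
Proof.
move=> df; have -> : (fun z => \sum_i a i * f i z) = \sum_i a i *: f i.
  by apply/funext => z; rewrite fct_sumE.
by apply: is_derive_sum => i; apply/is_deriveZ/derivableP/diff_derivable.
Qed.

(** The coefficients are linear in the fibre coordinate, hence the second sum of
    the Leibniz rule keeps them and the first one replaces them by [A]. *)
Lemma is_derive_field (A : 'M[R]_n) (f : 'I_n -> TU -> R) u l :
  (forall i, differentiable (f i) u) ->
  is_derive u (0 : 'cV[R]_n, basis_vec l)
    (fun z => \sum_i (A *m z.2) i 0 * f i z)
    (\sum_i A i l * f i u + \sum_i (A *m u.2) i 0 * d_y l (f i) u).
Proof.
move=> df; pose e : TU := (0, basis_vec l); pose a i (z : TU) : R := (A *m z.2) i 0.
have da i : is_derive u e (a i) (A i l).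
  apply: is_derive_affine => h; rewrite /a /= mulmxDr -scalemxAr.
  by rewrite mxE [X in X + _]mxE mulmx_basis_vec.
have -> : (fun z => \sum_i (A *m z.2) i 0 * f i z) = \sum_i (a i * f i).
  by apply/funext => z; rewrite fct_sumE.
rewrite addrC -big_split /=; apply: is_derive_sum => i.
have dfe : is_derive u e (f i) (d_y l (f i) u) by exact/derivableP/diff_derivable.
apply: is_derive_eq (is_deriveM (da i) dfe) _.
by congr (_ + _); exact: mulrC.
Qed.

End PairCalculus.

(** * Homogeneity and positivity of a Finsler function *)

Section Homogeneity.
Context {R : realType} {n : nat} {M : manifold R n}.
Variable F : forall p : M, tangent M p -> R.
Hypothesis hF : finsler F.
Implicit Types (c : chart R n M) (u : 'cV[R]_n * 'cV[R]_n).

Definition local_F2 c u : R := local_F F c u ^+ 2.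

Lemma smooth_local_F c : atlas c -> smooth_on (slit c) (local_F F c).
Proof. by case: hF => _ sF _ _; exact: sF. Qed.

Lemma smooth_local_F2 c : atlas c -> smooth_on (slit c) (local_F2 c).
Proof.
move=> ac; have -> : local_F2 c = local_F F c * local_F F c.
  by apply/funext => u; rewrite /local_F2 expr2.
exact (smooth_onM (open_slit (c:=c)) (smooth_local_F ac) (smooth_local_F ac)).
Qed.

Lemma g_lowE c i j : g_low F c i j = 2^-1 *: d_y i (d_y j (local_F2 c)).
Proof. by apply/funext => u; rewrite /g_low /fundamental mxE. Qed.

Lemma g_lowEu c i j u : g_low F c i j u = 2^-1 * d_y i (d_y j (local_F2 c)) u.
Proof. by rewrite /g_low /fundamental mxE. Qed.

Lemma differentiable_g_low c i j u : atlas c -> slit c u ->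
  differentiable (g_low F c i j) u.
Proof.
move=> ac su; rewrite g_lowE; apply: differentiableZ.
exact: (smooth_on_differentiable (smooth_on_derive _ (smooth_on_derive _ (smooth_local_F2 ac)))).
Qed.

Definition dilate (a : R) u : 'cV[R]_n * 'cV[R]_n := (u.1, a *: u.2).

Lemma dilate_affine a (h : R) v u :
  dilate a (h *: v + u) = h *: dilate a v + dilate a u.
Proof. by congr pair; rewrite /= scalerDr !scalerA mulrC. Qed.

Lemma slit_dilate c a u : 0 < a -> slit c u -> slit c (dilate a u).
Proof. by move=> a0 [cu u0]; split => //=; rewrite scaler_eq0 negb_or gt_eqF. Qed.

(** Differentiating f (x, a y) = b f (x, y) in the fibre: each fibre derivative
    lowers the degree of homogeneity by one. *)
Lemma d_y_homogeneous c (f : 'cV[R]_n * 'cV[R]_n -> R) (a b : R) i u :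
  smooth_on (slit c) f -> 0 < a ->
  (forall z, slit c z -> f (dilate a z) = b * f z) -> slit c u ->
  a * d_y i f (dilate a u) = b * d_y i f u.
Proof.
move=> sf a0 fh su; have df : differentiable f (dilate a u).
  exact/(smooth_on_differentiable sf)/slit_dilate.
have E : 'D_(0 : 'cV[R]_n, basis_vec i) (f \o dilate a) u = a * d_y i f (dilate a u).
  rewrite (derive_comp_affine (L := dilate a)); last exact: dilate_affine.
  have -> : dilate a (0 : 'cV[R]_n, basis_vec i) = a *: (0 : 'cV[R]_n, basis_vec i).
    by congr pair; rewrite /= scaler0.
  exact: deriveZl.
transitivity ('D_(0 : 'cV[R]_n, basis_vec i) (b *: f) u); last first.
  exact/deriveZ/diff_derivable/(smooth_on_differentiable sf).
by rewrite -E; apply: near_eq_derive; apply: (near_open (open_slit (c:=c)) su).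
Qed.

Lemma local_F2_homogeneous c (a : R) u : 0 < a ->
  local_F2 c (dilate a u) = a ^+ 2 * local_F2 c u.
Proof.
by move=> a0; rewrite /local_F2 /dilate -exprMn local_FZ //; case: u.
Qed.

Lemma g_low_homogeneous c (a : R) i j u : atlas c -> 0 < a -> slit c u ->
  g_low F c i j (dilate a u) = g_low F c i j u.
Proof.
move=> ac a0 su; rewrite !g_lowEu; apply: (congr1 ( *%R 2^-1)).
have sL := smooth_local_F2 ac.
have aN0 : a != 0 by rewrite gt_eqF.
have E z : slit c z -> d_y j (local_F2 c) (dilate a z) = a * d_y j (local_F2 c) z.
  move=> sz; apply: (mulfI aN0).
  rewrite (d_y_homogeneous (b := a ^+ 2) j sL a0 _ sz) => [|? _]; last exact: local_F2_homogeneous.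
  by rewrite expr2 mulrA.
apply: (mulfI aN0); apply: (d_y_homogeneous i _ a0 E su).
exact: smooth_on_derive.
Qed.

Lemma radial_line u (a h : R) :
  h *: (0 : 'cV[R]_n, u.2) + dilate a u = dilate (a + h) u.
Proof.
case: u => x y; rewrite /dilate; congr pair; rewrite /= ?scaler0 ?add0r //.
by rewrite addrC scalerDl.
Qed.

Lemma dilate1 u : dilate 1 u = u.
Proof. by case: u => x y; rewrite /dilate /= scale1r. Qed.

Lemma near_addr_gt0 (a : R) : 0 < a -> \forall h \near (0 : R), 0 < a + h.
Proof.
move=> a0; exists a => //= h; rewrite /= sub0r normrN => /ltr_normlP[].
by rewrite ltrNl -subr_gt0 opprK addrC.
Qed.

(** Euler's relation for the fundamental tensor, which is homogeneous of degree 0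
    and therefore constant along the rays of each fibre. *)
Lemma g_low_radial c i j u : atlas c -> slit c u ->
  \sum_k u.2 k 0 * d_y k (g_low F c i j) u = 0.
Proof.
move=> ac su; rewrite -(derive_d_y u.2 (differentiable_g_low i j ac su)).
transitivity ('D_(0 : 'cV[R]_n, u.2) (cst (g_low F c i j u)) u).
  apply: derive_eq_line; apply: filterS (near_addr_gt0 ltr01) => h h0.
  by rewrite -{2}(dilate1 u) radial_line g_low_homogeneous.
exact: derive_cst.
Qed.

Lemma radial_derive0 (f : 'cV[R]_n * 'cV[R]_n -> R) u :
  (forall a, 0 < a -> f (dilate a u) = 0) ->
  forall a, 0 < a -> 'D_(0 : 'cV[R]_n, u.2) f (dilate a u) = 0.
Proof.
move=> f0 a a0; transitivity ('D_(0 : 'cV[R]_n, u.2) (cst (0 : R)) (dilate a u)).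
  apply: derive_eq_line; apply: filterS (near_addr_gt0 a0) => h ah.
  by rewrite radial_line f0.
exact: derive_cst.
Qed.

Lemma fundamental_quadratic c u (y : 'cV[R]_n) : atlas c -> slit c u ->
  (y^T *m fundamental F c u *m y) 0 0 =
  2^-1 * 'D_(0 : 'cV[R]_n, y) ('D_(0 : 'cV[R]_n, y) (local_F2 c)) u.
Proof.
move=> ac su; have sL := smooth_local_F2 ac.
have D0 (f : 'cV[R]_n * 'cV[R]_n -> R) : smooth_on (slit c) f ->
    'D_(0 : 'cV[R]_n, y) f u = \sum_i y i 0 * d_y i f u.
  by move=> sf; apply: derive_d_y; exact: smooth_on_differentiable sf su.
rewrite D0; last exact: smooth_on_derive.
rewrite mxE mulr_sumr; apply: eq_bigr => j _.
rewrite /d_y (derive_swap _ _ (@open_slit _ _ _ c) sL su) D0; last exact: smooth_on_derive.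
rewrite mxE mulr_suml mulrCA mulr_sumr mulr_sumr; apply: eq_bigr => i _.
rewrite !mxE /d_y (derive_swap _ _ (@open_slit _ _ _ c) sL su).
by rewrite mulrC !mulrA; congr (_ * _); rewrite -!mulrA; congr (_ * _); rewrite mulrC.
Qed.

(** If F vanished at [u] it would vanish on the ray of [u], and then the second
    radial derivative of F^2, which is twice the fundamental quadratic form at
    the nonzero vector [u.2], would vanish as well. *)
Lemma local_F_gt0 c u : atlas c -> slit c u -> 0 < local_F F c u.
Proof.
move=> ac su; have [F0 _ _ gpos] := hF.
rewrite lt_neqAle F0 andbT eq_sym; apply/eqP => Fu0.
have := gpos c u ac su u.2 su.2; rewrite fundamental_quadratic //.
have L0 a : 0 < a -> local_F2 c (dilate a u) = 0.
  by move=> a0; rewrite local_F2_homogeneous // /local_F2 Fu0 expr0n mulr0.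
have := radial_derive0 (f := 'D_(0 : 'cV[R]_n, u.2) (local_F2 c))
  (radial_derive0 L0) ltr01.
by rewrite dilate1 => ->; rewrite mulr0 ltxx.
Qed.

End Homogeneity.

(** * Horizontal derivatives of the fundamental tensor *)

Section MetricCompatibility.
Context {R : realType} {n : nat} {M : manifold R n}.
Variable F : forall p : M, tangent M p -> R.
Variable D : affine_connection M.
Hypothesis hF : finsler F.
Hypothesis invF : transport_invariant F D.
Implicit Types (c : chart R n M) (u : 'cV[R]_n * 'cV[R]_n).

(** Homogeneity extends the equation from the indicatrix to all nonzero
    vectors: both F and the coefficients of the direction are homogeneous of
    degree 1 in [y]. *)
Lemma derive_local_F_horizontal c u v : atlas c -> slit c u ->
  'D_(v, - (aform D c u.1 v *m u.2)) (local_F F c) u = 0.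
Proof.
case: u => x y ac su; rewrite /=; pose w := (v, - (aform D c x v *m y)).
rewrite -/w; pose a := local_F F c (x, y).
have a0 : 0 < a by exact: local_F_gt0.
have dF : differentiable (local_F F c) (x, y).
  exact: (smooth_on_differentiable (smooth_local_F hF ac)).
have E : local_F F c \o dilate a^-1 = a^-1 *: local_F F c.
  by apply/funext => -[x' y']; rewrite /= local_FZ // invr_gt0.
have : 'D_w (local_F F c \o dilate a^-1) (x, y) = 0.
  rewrite (derive_comp_affine (L := dilate a^-1)); last exact: dilate_affine.
  have -> : dilate a^-1 w = (v, - (aform D c x v *m (a^-1 *: y))).
    by congr pair; rewrite /= scalerN scalemxAr.
  apply: derive_local_F_indicatrix => //.
    by case: su.
  by rewrite local_FZ ?invr_gt0 // mulVf // gt_eqF.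
rewrite E deriveZ; last exact: diff_derivable.
by move/eqP; rewrite scaler_eq0 invr_eq0 gt_eqF //= => /eqP.
Qed.

Lemma d_x_local_F2 c u k : atlas c -> slit c u ->
  d_x k (local_F2 F c) u =
  \sum_i (aform D c u.1 (basis_vec k) *m u.2) i 0 * d_y i (local_F2 F c) u.
Proof.
move=> ac su; set w := _ *m _.
have dF : differentiable (local_F F c) u.
  exact: (smooth_on_differentiable (smooth_local_F hF ac)).
have dL : differentiable (local_F2 F c) u.
  exact: (smooth_on_differentiable (smooth_local_F2 hF ac)).
have L2 : local_F2 F c = local_F F c * local_F F c.
  by apply/funext => z; rewrite /local_F2 expr2.
have : 'D_(basis_vec k, - w) (local_F2 F c) u = 0.
  rewrite L2 deriveM; [|exact: diff_derivable..].
  by rewrite derive_local_F_horizontal // scaler0 addr0.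
rewrite (derive_split _ _ dL) (derive_d_y _ dL) => /eqP.
rewrite addr_eq0 => /eqP E; apply: (etrans E).
by rewrite -sumrN; apply: eq_bigr => i _; rewrite mxE mulNr opprK.
Qed.

Lemma d_y_eq_fibre c (f g : 'cV[R]_n * 'cV[R]_n -> R) u l : slit c u ->
  (forall z, slit c z -> z.1 = u.1 -> f z = g z) -> d_y l f u = d_y l g u.
Proof.
move=> su fg; apply: derive_eq_line.
have : nbhs u (slit c) by apply: open_nbhs_nbhs; split => //; exact: open_slit.
move=> /near_line-/(_ (0 : 'cV[R]_n, basis_vec l)).
by apply: filterS => h sh; apply: fg => //=; rewrite scaler0 add0r.
Qed.

Lemma g_low_sym c i j u : atlas c -> slit c u ->
  g_low F c i j u = g_low F c j i u.
Proof.
move=> ac su; rewrite !g_lowEu; apply: (congr1 ( *%R 2^-1)).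
exact: (derive_swap _ _ (open_slit (c:=c)) (smooth_local_F2 hF ac)).
Qed.

Lemma d_y_g_low c i j k u : atlas c -> slit c u ->
  d_y k (g_low F c i j) u = 2^-1 * d_y k (d_y i (d_y j (local_F2 F c))) u.
Proof.
move=> ac su; rewrite g_lowE /d_y deriveZ //; apply/diff_derivable.
exact: (smooth_on_differentiable (smooth_on_derive _ (smooth_on_derive _ (smooth_local_F2 hF ac)))).
Qed.

Lemma d_y_swap c f i j u : smooth_on (slit c) f -> slit c u ->
  d_y i (d_y j f) u = d_y j (d_y i f) u.
Proof. by move=> sf su; exact: derive_swap (@open_slit _ _ _ c) sf su. Qed.

(** The Cartan tensor consists of third derivatives of F^2. *)
Lemma d_y_g_low_sym c i j k u : atlas c -> slit c u ->
  d_y k (g_low F c i j) u = d_y j (g_low F c i k) u.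
Proof.
move=> ac su; rewrite (d_y_g_low i j k ac su) (d_y_g_low i k j ac su).
apply: (congr1 ( *%R 2^-1)).
have sL := smooth_local_F2 hF ac; have oU := @open_slit _ _ _ c.
have sL1 r : smooth_on (slit c) (d_y r (local_F2 F c)) by exact: smooth_on_derive.
apply: (etrans (d_y_swap k i (sL1 j) su)).
apply: (etrans _ (d_y_swap i j (sL1 k) su)).
apply: near_eq_derive; apply: (near_open oU su) => z sz.
exact: d_y_swap sL sz.
Qed.

(** Two fibre derivatives of the identity of [d_x_local_F2]. Along a fibre the
    matrix [A] is constant, because the connection comes from the base; each
    derivative either hits the linear factor [A *m y] or passes to F^2. *)
Lemma d_x_g_low c i j k u : atlas c -> slit c u ->
  let A := aform D c u.1 (basis_vec k) in
  d_x k (g_low F c i j) u =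
  \sum_r A r i * g_low F c r j u + \sum_r A r j * g_low F c i r u
  + \sum_r (A *m u.2) r 0 * d_y r (g_low F c i j) u.
Proof.
move=> ac su A; have sL := smooth_local_F2 hF ac.
have oU := @open_slit _ _ _ c.
have dL1 r z : slit c z -> differentiable (d_y r (local_F2 F c)) z.
  exact: (smooth_on_differentiable (smooth_on_derive _ sL)).
have dL2 r s z : slit c z -> differentiable (d_y r (d_y s (local_F2 F c))) z.
  exact: (smooth_on_differentiable (smooth_on_derive _ (smooth_on_derive _ sL))).
have E1 z : slit c z -> z.1 = u.1 -> d_y j (d_x k (local_F2 F c)) z =
    \sum_r A r j * d_y r (local_F2 F c) z
    + \sum_r (A *m z.2) r 0 * d_y j (d_y r (local_F2 F c)) z.
  move=> sz zu.
  pose q z' := \sum_r (A *m z'.2) r 0 * d_y r (local_F2 F c) z'.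
  have dq : forall z', slit c z' -> z'.1 = z.1 -> d_x k (local_F2 F c) z' = q z'.
    by move=> z' sz' z'z; rewrite d_x_local_F2 // z'z zu.
  apply: (etrans (d_y_eq_fibre j sz dq)).
  exact: (@derive_val _ _ _ _ _ _ _ (is_derive_field A j (fun r => dL1 r z sz))).
have E2 : d_y i (d_y j (d_x k (local_F2 F c))) u =
    \sum_r A r j * d_y i (d_y r (local_F2 F c)) u
    + (\sum_r A r i * d_y j (d_y r (local_F2 F c)) u
    + \sum_r (A *m u.2) r 0 * d_y i (d_y j (d_y r (local_F2 F c))) u).
  apply: (etrans (d_y_eq_fibre i su E1)).
  have d1 := is_derive_lincomb (fun r => A r j) (0 : 'cV[R]_n, basis_vec i)
    (fun r => dL1 r u su).
  have d2 := is_derive_field A i (fun r => dL2 j r u su).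
  exact: (@derive_val _ _ _ _ _ _ _ (is_deriveD d1 d2)).
have E3 : d_x k (d_y i (d_y j (local_F2 F c))) u =
    d_y i (d_y j (d_x k (local_F2 F c))) u.
  apply: (etrans (derive_swap (basis_vec k, 0) (0, basis_vec i) oU
    (smooth_on_derive _ sL) su)).
  apply: near_eq_derive; apply: (near_open oU su) => z sz.
  exact: derive_swap oU sL sz.
have E4 : d_x k (g_low F c i j) u = 2^-1 * d_x k (d_y i (d_y j (local_F2 F c))) u.
  by rewrite g_lowE; exact/deriveZ/diff_derivable/dL2.
rewrite E4 E3 E2 addrCA addrA !mulrDr; congr (_ + _ + _); rewrite mulr_sumr;
  apply: eq_bigr => r _.
- by rewrite (g_low_sym r j ac su) g_lowEu; exact: mulrCA.
- by rewrite g_lowEu; exact: mulrCA.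
rewrite -(d_y_g_low_sym i r j ac su) (d_y_g_low i r j ac su).
by rewrite (d_y_swap j i (smooth_on_derive _ sL) su); exact: mulrCA.
Qed.

End MetricCompatibility.

(** * The nonlinear connection of a Finsler function with invariant indicatrix *)

(** Pointwise dictionary: [G] is g_ij, [T k] the matrix of the connection form
    of d/dx^k, [C i j k] is dg_ij/dy^k, [dG k i j] is dg_ij/dx^k and [a] is the
    value of F. Then [N] is the candidate for the nonlinear connection, [ch] the
    formal Christoffel symbol and [S] the spray. *)
Section ChristoffelContraction.
Variables (R : numFieldType) (n : nat).
Variables (G : 'M[R]_n) (T : 'I_n -> 'M[R]_n) (C dG : 'I_n -> 'I_n -> 'I_n -> R).
Variables (y : 'I_n -> R) (a : R).
Hypothesis Gunit : G \in unitmx.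
Hypothesis Gsym : forall i j, G i j = G j i.
Hypothesis Tsym : forall i j k, T k i j = T j i k.
Hypothesis Csym23 : forall i j k, C i j k = C i k j.
Hypothesis Cy : forall i j, \sum_k y k * C i j k = 0.
Let N r k := \sum_j T k r j * y j.
Hypothesis dGE : forall k i j, dG k i j =
  \sum_r T k r i * G r j + \sum_r T k r j * G i r + \sum_r N r k * C i j r.
Hypothesis a0 : a != 0.

Let ch i j k := 2^-1 * \sum_s invmx G i s * (dG k s j - dG s j k + dG j s k).
Let S r := \sum_k N r k * y k.

(** By the symmetry of [T] the connection terms combine as in the Koszul formula;
    the terms in [C] remain. *)
Lemma christoffel_bracket s j k : dG k s j - dG s j k + dG j s k =
  2 * (\sum_r G s r * T k r j) +
  \sum_r (N r k * C s j r - N r s * C j k r + N r j * C s k r).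
Proof.
rewrite !dGE mulr_sumr -!big_split /= -sumrN -!big_split /=; apply: eq_bigr => r _.
rewrite (Tsym r s k) (Gsym j r) (Tsym r j s) (Tsym r k j).
by ring.
Qed.

Lemma christoffel_split i j k : ch i j k = T k i j + 2^-1 *
  \sum_s invmx G i s * \sum_r (N r k * C s j r - N r s * C j k r + N r j * C s k r).
Proof.
have E : \sum_s invmx G i s * (\sum_r G s r * T k r j) = T k i j.
  have := mulKmx Gunit (T k) => /matrixP/(_ i j); rewrite mxE => E.
  by rewrite -[RHS]E; apply: eq_bigr => s _; rewrite mxE.
rewrite -[X in X + _]E /ch.
under eq_bigr => s _ do rewrite christoffel_bracket mulrDr mulrCA.
by rewrite big_split /= -mulr_sumr mulrDr mulKf // pnatr_eq0.
Qed.

Lemma contract_lincomb (b : 'I_n -> R) (f : 'I_n -> 'I_n -> R) :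
  \sum_k (\sum_s b s * f s k) * y k = \sum_s b s * \sum_k f s k * y k.
Proof.
transitivity (\sum_k \sum_s b s * f s k * y k).
  by apply: eq_bigr => k _; rewrite mulr_suml.
rewrite exchange_big; apply: eq_bigr => s _; rewrite mulr_sumr.
by apply: eq_bigr => k _; rewrite mulrA.
Qed.

Lemma contract_cartan (b : R) i r : \sum_k b * C i k r * y k = 0.
Proof.
transitivity (b * \sum_k y k * C i r k); last by rewrite Cy mulr0.
by rewrite mulr_sumr; apply: eq_bigr => k _; rewrite Csym23; ring.
Qed.

(** Contraction with y kills the two terms in [C] that carry the index [k], by
    Euler's relation, and leaves the term in which the spray appears. *)
Lemma christoffel_contract i j : \sum_k ch i j k * y k =
  N i j + 2^-1 * \sum_s invmx G i s * \sum_r S r * C s j r.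
Proof.
under eq_bigr => k _ do rewrite christoffel_split mulrDl -(mulrA 2^-1).
rewrite big_split -mulr_sumr contract_lincomb /=; congr (_ + _ * _).
  by apply: eq_bigr => k _; rewrite Tsym.
apply: eq_bigr => s _; congr (_ * _).
transitivity (\sum_k \sum_r (N r k * C s j r - N r s * C j k r
    + N r j * C s k r) * y k).
  by apply: eq_bigr => k _; rewrite mulr_suml.
rewrite exchange_big; apply: eq_bigr => r _ /=.
under eq_bigr => k _ do rewrite mulrDl mulrBl.
rewrite big_split sumrB /= !contract_cartan subr0 addr0 /S mulr_suml.
by apply: eq_bigr => k _; rewrite mulrAC.
Qed.

(** The remaining term in [C] also dies at the second contraction with y. *)
Lemma spray_contract k : \sum_r \sum_s ch k r s * y r * y s = S k.
Proof.
transitivity (\sum_r (\sum_s ch k r s * y s) * y r).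
  by apply: eq_bigr => r _; rewrite mulr_suml; apply: eq_bigr => s _; rewrite mulrAC.
under eq_bigr => r _ do rewrite christoffel_contract mulrDl -(mulrA 2^-1).
rewrite big_split -mulr_sumr contract_lincomb /= [X in 2^-1 * X]big1 ?mulr0 ?addr0 // => s _.
rewrite [X in _ * X](_ : _ = 0) ?mulr0 //.
transitivity (\sum_r \sum_t S t * C s r t * y r).
  by apply: eq_bigr => r _; rewrite mulr_suml.
by rewrite exchange_big big1 // => t _; exact: contract_cartan.
Qed.

(** The Cartan correction in the definition of the nonlinear connection is
    exactly the term in [C] left over by [christoffel_contract]. *)
Lemma nonlinear_connection_compatible i j :
  \sum_k ch i j k * y k
  - a^-1 * \sum_k \sum_r \sum_s
      (\sum_t invmx G i t * (a / 2 * C t j k)) * ch k r s * y r * y s = N i j.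
Proof.
rewrite christoffel_contract; apply/eqP; rewrite subr_eq; apply/eqP; congr (_ + _).
transitivity (a^-1 * \sum_k (\sum_t invmx G i t * (a / 2 * C t j k)) * S k); last first.
  congr (_ * _); apply: eq_bigr => k _; rewrite -spray_contract mulr_sumr.
  by apply: eq_bigr => r _; rewrite mulr_sumr; apply: eq_bigr => s _; rewrite !mulrA.
rewrite !mulr_sumr; under [RHS]eq_bigr => k _ do rewrite mulr_suml mulr_sumr.
rewrite [RHS]exchange_big /=; apply: eq_bigr => s _.
rewrite !mulr_sumr; apply: eq_bigr => k _.
by field.
Qed.

End ChristoffelContraction.

Section Chern.
Context {R : realType} {n : nat} {M : manifold R n}.
Variable F : forall p : M, tangent M p -> R.
Variable D : affine_connection M.
Hypothesis hF : finsler F.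
Hypothesis invF : transport_invariant F D.
Hypothesis torsion_free : forall c x v w, atlas c -> chart_cod c x ->
  aform D c x v *m w = aform D c x w *m v.
Implicit Types (c : chart R n M) (u : 'cV[R]_n * 'cV[R]_n).

(** A vector in the kernel would have length 0 for a positive definite form. *)
Lemma fundamental_unitmx c u : atlas c -> slit c u ->
  fundamental F c u \in unitmx.
Proof.
move=> ac su; rewrite -row_free_unit; apply/inj_row_free => v vG.
apply/eqP; apply: contraT => v0; case: hF => _ _ _ /(_ c u ac su v^T).
rewrite trmx_eq0 => /(_ v0); rewrite trmxK vG mul0mx mxE ltxx.
by [].
Qed.

Lemma aform_basis_sym c x i j k : atlas c -> chart_cod c x ->
  aform D c x (basis_vec k) i j = aform D c x (basis_vec j) i k.
Proof.
move=> ac cx; rewrite -(mulmx_basis_vec (aform D c x (basis_vec k))).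
by rewrite torsion_free // mulmx_basis_vec.
Qed.

Lemma nonlinear_connectionE c i j u : atlas c -> slit c u ->
  nonlinear_connection F c i j u = (aform D c u.1 (basis_vec j) *m u.2) i 0.
Proof.
move=> ac su; rewrite mxE /nonlinear_connection.
have Gsym r s : fundamental F c u r s = fundamental F c u s r.
  exact: (g_low_sym hF).
apply: (nonlinear_connection_compatible
  (T := fun k => aform D c u.1 (basis_vec k)) (y := fun k => u.2 k 0)
  (C := fun i j k => d_y k (g_low F c i j) u)
  (dG := fun k i j => d_x k (g_low F c i j) u)
  (fundamental_unitmx ac su) Gsym).
- by move=> r s t; apply: aform_basis_sym => //; case: su.
- by move=> r s t; exact: d_y_g_low_sym.
- by move=> r s; exact: g_low_radial.
- move=> k r s /=; rewrite (d_x_g_low hF invF) //; congr (_ + _).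
  by apply: eq_bigr => t _; rewrite mxE.
- by rewrite gt_eqF // local_F_gt0.
Qed.

End Chern.

(** * The pull-back connection is the Chern connection *)

Section PullBack.
Context {R : realType} {n : nat} {M : manifold R n}.
Variable D : affine_connection M.
Implicit Types (c d : chart R n M) (u V : 'cV[R]_n * 'cV[R]_n).

Definition pullback_form c u V : 'M[R]_n := aform D c u.1 V.1.

Lemma pullback_form_linear c u : atlas c -> slit c u -> linear (pullback_form c u).
Proof. by move=> ac [cu _] a V W; exact: aform_linear. Qed.

Lemma differentiable_fst u : differentiable (fst : 'cV[R]_n * 'cV[R]_n -> 'cV[R]_n) u.
Proof. by apply: linear_differentiable => z; exact: cvg_fst. Qed.

Lemma differentiable_snd u : differentiable (snd : 'cV[R]_n * 'cV[R]_n -> 'cV[R]_n) u.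
Proof. by apply: linear_differentiable => z; exact: cvg_snd. Qed.

Lemma pullback_form_smooth c V : atlas c ->
  smooth_on (slit c) (fun u => pullback_form c u V).
Proof.
move=> ac vs u [cu _].
have fst_affine (h : R) (w x : 'cV[R]_n * 'cV[R]_n) :
  (h *: w + x).1 = h *: w.1 + x.1 by [].
have sm := smooth_on_comp_affine fst_affine differentiable_fst
  (@aform_smooth _ _ _ D c V.1 ac).
exact: (sm vs u cu).
Qed.

(** The derivative of a pair is taken componentwise only where both components
    are derivable, hence the detour through the fibre component. *)
Lemma derive_tangent_transition c d u V : atlas c -> atlas d ->
  overlap c d u.1 ->
  ('D_V (tangent_transition c d) u).1 = jac (transition c d) u.1 *m V.1.
Proof.
move=> ac ad cdu; have [sm _] := atlas_compatible ac ad.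
have dt : differentiable (transition c d) u.1 by exact: smooth_on_differentiable sm cdu.
have D1 : differentiable (transition c d \o fst) u.
  by apply: differentiable_comp dt; exact: differentiable_fst.
have D2 : derivable (fun z : 'cV[R]_n * 'cV[R]_n => jac (transition c d) z.1 *m z.2) u V.
  apply/derivable_mxP => i j.
  pose a k (z : 'cV[R]_n * 'cV[R]_n) := ('D_(basis_vec k) (transition c d) z.1) i 0.
  pose b k (z : 'cV[R]_n * 'cV[R]_n) := z.2 k j.
  have -> : (fun z : 'cV[R]_n * 'cV[R]_n => (jac (transition c d) z.1 *m z.2) i j)
      = \sum_k (a k * b k).
    by apply/funext => z; rewrite fct_sumE mxE; apply: eq_bigr => k _; rewrite mxE.
  apply: derivable_sum => k; apply: derivableM; apply: diff_derivable.
    apply: (differentiable_comp (f := fst)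
      (g := fun x => ('D_(basis_vec k) (transition c d) x) i 0)).
      exact: differentiable_fst.
    apply: (differentiable_comp (f := 'D_(basis_vec k) (transition c d))
      (g := fun N : 'cV[R]_n => N i 0)); last exact: differentiable_coord.
    exact: (smooth_on_differentiable (smooth_on_derive _ sm)).
  apply: (differentiable_comp (f := snd) (g := fun N : 'cV[R]_n => N k j)).
    exact: differentiable_snd.
  exact: differentiable_coord.
rewrite /tangent_transition (derive_pair (diff_derivable D1) D2) /=.
rewrite (derive_comp_affine (L := fst) (A := fst)) //.
by rewrite deriveE // jacE.
Qed.

Lemma pullback_form_change c d u V : atlas c -> atlas d -> slit c u ->
  overlap c d u.1 ->
  let J := jac (transition c d) in
  let T := tangent_transition c d in
  'D_V (fun z => J z.1) u + pullback_form d (T u) ('D_V T u) *m J u.1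
  = J u.1 *m pullback_form c u V.
Proof.
move=> ac ad su cdu J T; rewrite /pullback_form derive_tangent_transition //.
rewrite -(aform_change D V.1 ac ad cdu) /=; congr (_ + _).
Qed.

Definition pullback_affine : pullback_connection M :=
  PullbackConnection pullback_form_linear pullback_form_smooth pullback_form_change.

Lemma aform_basis c x v i j : atlas c -> chart_cod c x ->
  aform D c x v i j = \sum_k aform D c x (basis_vec k) i j * v k 0.
Proof.
move=> ac cx.
pose L : {linear 'cV[R]_n -> 'M[R]_n} := HB.pack (aform D c x)
  (GRing.isLinear.Build _ _ _ _ _ (aform_linear D ac cx)).
rewrite {1}(basis_vecE v) -[aform D c x]/(L : _ -> _) linear_sum summxE.
by apply: eq_bigr => k _; rewrite linearZ mxE mulrC.
Qed.

End PullBack.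

Lemma contract_three_sums (R : comRingType) n (v p q s : 'I_n -> R)
    (a b d : 'I_n -> 'I_n -> R) :
  \sum_k v k * (\sum_r a k r * p r + \sum_r b k r * q r + \sum_r d k r * s r) =
  \sum_r p r * (\sum_k a k r * v k) + \sum_r q r * (\sum_k b k r * v k)
  + \sum_r (\sum_k d k r * v k) * s r.
Proof.
have E (a' : 'I_n -> 'I_n -> R) p' :
    \sum_k v k * (\sum_r a' k r * p' r) = \sum_r p' r * (\sum_k a' k r * v k).
  transitivity (\sum_k \sum_r v k * (a' k r * p' r)).
    by apply: eq_bigr => k _; rewrite mulr_sumr.
  rewrite exchange_big; apply: eq_bigr => r _; rewrite mulr_sumr.
  by apply: eq_bigr => k _; ring.
transitivity (\sum_k (v k * (\sum_r a k r * p r) + v k * (\sum_r b k r * q r)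
    + v k * (\sum_r d k r * s r))).
  by apply: eq_bigr => k _; rewrite !mulrDr.
rewrite !big_split !E; congr (_ + _); apply: eq_bigr => r _; exact: mulrC.
Qed.

(** With the nonlinear connection identified as [A *m y], the identity of
    [d_x_g_low] is the horizontal part of the structure equation of the Chern
    connection; the vertical part is the definition of the Cartan tensor. *)
Theorem chern_connection_pullback (R : realType) (n : nat) (M : manifold R n)
  (F : forall p : M, tangent M p -> R) (D : affine_connection M) :
  finsler F ->
  (forall c x v w, atlas c -> chart_cod c x ->
    aform D c x v *m w = aform D c x w *m v) ->
  transport_invariant F D ->
  chern_connection F (pullback_affine D)
    (fun c i j k u => aform D c u.1 (basis_vec k) i j).
Proof.
move=> hF torsion_free invF c u ac su g w.
have cu : chart_cod c u.1 by case: su.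
have wE V i j : w V i j = \sum_k aform D c u.1 (basis_vec k) i j * V.1 k 0.
  exact: aform_basis.
split=> [//|i j k|V i j]; first exact: aform_basis_sym.
have dg := differentiable_g_low hF i j ac su.
have dgV : 'D_V (g_low F c i j) u =
    \sum_k V.1 k 0 * d_x k (g_low F c i j) u + \sum_k V.2 k 0 * d_y k (g_low F c i j) u.
  by case: V => v1 v2; rewrite (derive_split _ _ dg) derive_d_x // derive_d_y.
apply: (etrans (congr1 (fun t => t - _ - _) dgV)).
pose A k := aform D c u.1 (basis_vec k).
have hor : \sum_k V.1 k 0 * d_x k (g_low F c i j) u =
    \sum_r g u r j * (\sum_k A k r i * V.1 k 0)
    + \sum_r g u i r * (\sum_k A k r j * V.1 k 0)
    + \sum_r (\sum_k (A k *m u.2) r 0 * V.1 k 0) * d_y r (g_low F c i j) u.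
  apply: (etrans _ (contract_three_sums (fun k => V.1 k 0) (fun r => g u r j)
    (fun r => g u i r) (fun r => d_y r (g_low F c i j) u) (fun k r => A k r i)
    (fun k r => A k r j) (fun k r => (A k *m u.2) r 0))).
  apply: eq_bigr => k _; apply: (congr1 ( *%R (V.1 k 0))).
  exact: (d_x_g_low hF invF i j k ac su).
have EN r : delta_y F c r u V = V.2 r 0 + \sum_k (A k *m u.2) r 0 * V.1 k 0.
  apply: (congr1 ( +%R _)); apply: eq_bigr => k _.
  by rewrite (nonlinear_connectionE hF invF torsion_free).
have wi : \sum_r g u r j * w V r i = \sum_r g u r j * (\sum_k A k r i * V.1 k 0).
  by apply: eq_bigr => r _; rewrite wE.
have wj : \sum_r g u i r * w V r j = \sum_r g u i r * (\sum_k A k r j * V.1 k 0).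
  by apply: eq_bigr => r _; rewrite wE.
have cancel (p q r s p' q' l : R) : p = p' -> q = q' -> l = p' + q' + r ->
    l + s - p - q = r + s.
  by move=> -> -> ->; ring.
apply: (etrans (cancel _ _ _ _ _ _ _ wi wj hor)).
rewrite -big_split mulr_sumr; apply: eq_bigr => r _ /=.
have F0 : local_F F c u != 0 by rewrite gt_eqF // local_F_gt0.
by rewrite EN /cartan; field.
Qed.

Theorem proposition5p3p7 (R : realType) (n : nat) (M : manifold R n)
  (F : forall p : M, tangent M p -> R) (hF : finsler F)
  (hinv : exists (h : forall p : M, tangent M p -> tangent M p -> R)
                 (D : affine_connection M),
    [/\ riemannian h, levi_civita h D
      & forall (gamma : R -> M) (a b : R), a < b -> smooth_path gamma a b ->
          [set z | exists2 y, indicatrix F (gamma a) y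
                            & parallel_transport D y z]
          = indicatrix F (gamma b)]) :
  berwald F.
Proof.
case: hinv => h [D [_ lcD invF]].
exists (pullback_affine D), (fun c i j k u => aform D c u.1 (basis_vec k) i j).
split=> //; apply: chern_connection_pullback => // c x v w ac cx.
by have [] := lcD c x ac cx.
Qed.
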